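(* Let $f,m,N,\varpi,a_0,a_\phi$ be smooth functions of $R$ on an open interval with $f,m,N>0$, let $g,A$ be the metric and potential of the context, let $F=dA$, and define, with $'=\frac{d}{dR}$, $$\alpha=2\sqrt{-f(a_\phi')^2+\frac{N}{m}(a_0'+\varpi a_\phi')^2},\qquad \beta=\frac{2f a_\phi}{m}.$$ Assume the quantity under the square root is positive. Then: (i) The eigenvalues of $F^\mu{}_\nu$ are $0,\pm\alpha,\pm i\beta$, and there is a real null frame $\ell,n,m_{(2)},m_{(3)},m_{(4)}$, with $\ell,n$ eigenvectors of $F^\mu{}_\nu$ with eigenvalues $\pm\alpha$ and $m_{(2)}$ an eigenvector with eigenvalue $0$, in which $$F_{\mu\nu}=2\alpha\,\ell_{[\mu}n_{\nu]}-2\beta\,m^{(3)}_{[\mu}m^{(4)}_{\nu]} .$$ Consequently both $F_{\mu\nu}$ and the stress-energy tensor $T_{\mu\nu}=F_{\mu\rho}F_\nu{}^\rho-\frac14 g_{\mu\nu}F_{\rho\sigma}F^{\rho\sigma}$ are of algebraic type D with respect to this frame. This holds without imposing any field equations. (ii) If in addition the Einstein equations $R_{\mu\nu}-\frac12 \mathcal R g_{\mu\nu}=2T_{\mu\nu}$ hold, then $$R_{\mu\nu}=-\frac43(2\alpha^2+\beta^2)\,\ell_{(\mu}n_{\nu)}+\frac23(\alpha^2-\beta^2)\,m^{(2)}_\mu m^{(2)}_\nu+\frac23(\alpha^2+2\beta^2)\big(m^{(3)}_\mu m^{(3)}_\nu+m^{(4)}_\mu m^{(4)}_\nu\big),$$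 so the Ricci tensor is of type D, aligned with $F$; moreover, up to scaling, $\ell$ and $n$ are the only real null vectors $v$ with $R_{\mu\nu}v^\mu v^\nu=0$.
   Context: The ansatz, in coordinates $(t,R,\theta,\phi,\psi)$, $0<\theta<\pi/2$, is $$ds^2=-f\,dt^2+\frac{m}{f}\Big(\frac{dR^2}{4N}+d\theta^2\Big)+\frac{N}{m}\Big[\sin^2\theta\,(d\phi-\varpi\,dt)^2+\cos^2\theta\,(d\psi-\varpi\,dt)^2\Big]+\frac{m^2-fN}{m f}\sin^2\theta\cos^2\theta\,(d\phi-d\psi)^2,$$ $$A=a_0\,dt+a_\phi(\sin^2\theta\,d\phi+\cos^2\theta\,d\psi).$$ The function $m$ is not to be confused with the frame vectors $m_{(i)}$. A (real) null frame consists of vectors $\ell,n,m_{(2)},m_{(3)},m_{(4)}$ whose only non-vanishing scalar products are $\ell\cdot n=1$ and $m_{(i)}\cdot m_{(j)}=\delta_{ij}$, so $g_{\mu\nu}=2\ell_{(\mu}n_{\nu)}+\delta_{ij}m^{(i)}_\mu m^{(j)}_\nu$; round and square brackets on indices denote normalized (anti)symmetrization. The boost weight of a frame component of a tensor is the power of $\lambda$ it acquires under $\ell\mapsto\lambda\ell$, $n\mapsto\lambda^{-1}n$. A tensor is of (algebraic) type D with respect to the frame if only its components of boost weight zero may be non-vanishing. $R_{\mu\nu}$ is the Ricci tensor and $\mathcal R$ the scalar curvature. *)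

(* Defs.v *)
From HB Require Import structures.
From mathcomp Require Import all_boot all_order all_algebra.
From mathcomp Require Import all_classical all_reals all_analysis.
From mathcomp Require Import complex.

Set Implicit Arguments.
Unset Strict Implicit.
Unset Printing Implicit Defensive.

Import Order.TTheory GRing.Theory Num.Theory.
Import numFieldNormedType.Exports.

Local Open Scope classical_set_scope.
Local Open Scope ring_scope.

(* Points of the coordinate chart R^n are row vectors, tangent vectors (upper
   index) are columns, covectors (lower index) are rows, and a tensor T_{ij}
   with two lower indices is the square matrix with entries T i j. *)

Section Smoothness.
Variable R : realType.

(* Only meant for open sets I and U. *)
Definition smooth_on_line (I : set R) (u : R -> R) : Prop :=
  forall (k : nat) (r : R), I r -> derivable (derive1n k u) r 1.

Variable n : nat.

Definition pderiv (i : 'I_n) (h : 'rV[R]_n -> R) : 'rV[R]_n -> R :=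
  fun p => 'D_(delta_mx 0 i) h p.

Definition iter_pderiv (s : seq 'I_n) (h : 'rV[R]_n -> R) : 'rV[R]_n -> R :=
  foldr pderiv h s.

Definition smooth_on (U : set 'rV[R]_n) (h : 'rV[R]_n -> R) : Prop :=
  forall (s : seq 'I_n) (p : 'rV[R]_n), U p ->
    {for p, continuous (iter_pderiv s h)} /\
    forall i : 'I_n, derivable (iter_pderiv s h) p (delta_mx 0 i).

End Smoothness.

Section TensorAlgebra.
Variables (R : realType) (n : nat).
Implicit Types (g F T : 'M[R]_n) (u v : 'cV[R]_n) (a b : 'rV[R]_n).

Definition sqr_form a : 'M[R]_n := a^T *m a.

Definition sym a b : 'M[R]_n := 2^-1 *: (a^T *m b + b^T *m a).

Definition asym a b : 'M[R]_n := 2^-1 *: (a^T *m b - b^T *m a).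

Definition eval2 T u v : R := (u^T *m T *m v) 0 0.

Definition flat g v : 'rV[R]_n := (g *m v)^T.

(* F^i_j, with row index i and column index j; it acts on vectors by
   v |-> mixed g F *m v. *)
Definition mixed g F : 'M[R]_n := invmx g *m F.

Definition contract2 g F : R :=
  \sum_i \sum_j \sum_k \sum_l F i j * invmx g i k * invmx g j l * F k l.

(* T_{ij} = F_{ik} F_j^k - 1/4 g_{ij} F_{kl} F^{kl} *)
Definition stress_energy g F : 'M[R]_n :=
  F *m invmx g *m F^T - (4^-1 * contract2 g F) *: g.

End TensorAlgebra.

Definition is_eigenvector (K : fieldType) (n : nat) (M : 'M[K]_n)
    (v : 'cV[K]_n) (a : K) : Prop :=
  v != 0 /\ M *m v = a *: v.

Section TensorCalculus.
Variables (R : realType) (n : nat).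
Implicit Types (g : 'rV[R]_n -> 'M[R]_n) (A : 'rV[R]_n -> 'rV[R]_n).
Implicit Types (i j k l s : 'I_n) (p : 'rV[R]_n).

(* (dA)_{ij} = d_i A_j - d_j A_i *)
Definition ext_deriv A p : 'M[R]_n :=
  \matrix_(i, j) (pderiv i (fun q => A q 0 j) p - pderiv j (fun q => A q 0 i) p).

(* Gamma^k_{ij} of the Levi-Civita connection *)
Definition christoffel g k i j p : R :=
  2^-1 * \sum_l invmx (g p) k l *
    (pderiv i (fun q => g q l j) p + pderiv j (fun q => g q l i) p
     - pderiv l (fun q => g q i j) p).

(* R^k_{lij} = d_i Gamma^k_{jl} - d_j Gamma^k_{il}
               + Gamma^k_{is} Gamma^s_{jl} - Gamma^k_{js} Gamma^s_{il} *)
Definition riemann g k l i j p : R :=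
  pderiv i (christoffel g k j l) p - pderiv j (christoffel g k i l) p
  + \sum_s (christoffel g k i s p * christoffel g s j l p
            - christoffel g k j s p * christoffel g s i l p).

(* R_{lj} = R^k_{lkj}, which is positive on round spheres *)
Definition ricci g p : 'M[R]_n :=
  \matrix_(l, j) \sum_k riemann g k l k j p.

Definition scalar_curvature g p : R :=
  \sum_i \sum_j invmx (g p) i j * ricci g p i j.

End TensorCalculus.

(* A frame is indexed as in (l, n, m_(2), m_(3), m_(4)): entries 0 and 1 are
   l and n, entries 2, 3, 4 are the m_(i). *)
Section NullFrame.
Variable R : realType.
Implicit Types (e : 'I_5 -> 'cV[R]_5) (g T : 'M[R]_5).

Definition null_frame g e : Prop :=
  [/\ eval2 g (e 0) (e 1) = 1,
      eval2 g (e 0) (e 0) = 0,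
      eval2 g (e 1) (e 1) = 0,
      (forall i : 'I_5, (2 <= i)%N ->
         eval2 g (e 0) (e i) = 0 /\ eval2 g (e 1) (e i) = 0) &
      (forall i j : 'I_5, (2 <= i)%N -> (2 <= j)%N ->
         eval2 g (e i) (e j) = (i == j)%:R)].

Definition boost (lam : R) e : 'I_5 -> 'cV[R]_5 :=
  fun a => if a == 0 then lam *: e 0
           else if a == 1 then lam^-1 *: e 1 else e a.

(* The power of lam that the component (a, b) acquires whatever T is, so that a
   component which happens to vanish still has a unique boost weight. *)
Definition has_boost_weight (a b : 'I_5) (w : int) : Prop :=
  forall T e (lam : R), lam != 0 ->
    eval2 T (boost lam e a) (boost lam e b) = lam ^ w * eval2 T (e a) (e b).

Definition type_D T e : Prop :=
  forall a b : 'I_5, eval2 T (e a) (e b) <> 0 -> has_boost_weight a b 0.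

End NullFrame.

Section Ansatz.
Variable R : realType.
Variables f m N w a0 aphi : R -> R.
Implicit Types p : 'rV[R]_5.

(* coordinates (t, R, theta, phi, psi) *)
Definition cR p : R := p 0 1.
Definition ctheta p : R := p 0 2.

Definition chart (I : set R) : set 'rV[R]_5 :=
  [set p | I (cR p) /\ 0 < ctheta p < pi / 2].

Definition dt : 'rV[R]_5 := delta_mx 0 0.
Definition dR : 'rV[R]_5 := delta_mx 0 1.
Definition dtheta : 'rV[R]_5 := delta_mx 0 2.
Definition dphi : 'rV[R]_5 := delta_mx 0 3.
Definition dpsi : 'rV[R]_5 := delta_mx 0 4.

Definition metric p : 'M[R]_5 :=
  let r := cR p in let th := ctheta p in
  - f r *: sqr_form dt
  + (m r / f r) *: ((4 * N r)^-1 *: sqr_form dR + sqr_form dtheta)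
  + (N r / m r) *: (sin th ^+ 2 *: sqr_form (dphi - w r *: dt)
                    + cos th ^+ 2 *: sqr_form (dpsi - w r *: dt))
  + ((m r ^+ 2 - f r * N r) / (m r * f r) * sin th ^+ 2 * cos th ^+ 2)
      *: sqr_form (dphi - dpsi).

Definition potential p : 'rV[R]_5 :=
  let r := cR p in let th := ctheta p in
  a0 r *: dt + aphi r *: (sin th ^+ 2 *: dphi + cos th ^+ 2 *: dpsi).

Definition field_strength p : 'M[R]_5 := ext_deriv potential p.

Definition alpha_radicand (r : R) : R :=
  - f r * derive1 aphi r ^+ 2 + N r / m r * (derive1 a0 r + w r * derive1 aphi r) ^+ 2.

Definition alpha (r : R) : R := 2 * Num.sqrt (alpha_radicand r).

Definition beta (r : R) : R := 2 * f r * aphi r / m r.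

Definition einstein_equations (U : set 'rV[R]_5) : Prop :=
  forall p, U p ->
    ricci metric p - (2^-1 * scalar_curvature metric p) *: metric p
    = 2 *: stress_energy (metric p) (field_strength p).

End Ansatz.

(* Main.v *)
(** The metric splits as
      g = - f dt^2 + (N/m) (sigma - w dt)^2 + m/(4 f N) dR^2
          + (m/f) (dtheta^2 + sin^2 cos^2 (dphi - dpsi)^2),
    where sigma = sin^2 dphi + cos^2 dpsi, and since
    dsigma = 2 sin cos dtheta /\ (dphi - dpsi),
      F = dR /\ (a0' dt + aphi' sigma) + 2 aphi sin cos dtheta /\ (dphi - dpsi).
    The positivity of the radicand says that the 1-form a0' dt + aphi' sigma is
    timelike, so that its null combinations with dR give l and n, whereas the
    magnetic part lives in the plane of m_(3) and m_(4).  Everything else is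
    linear algebra in this frame: the trace of the Einstein equations determines
    the scalar curvature, hence the Ricci tensor, from F alone, and no curvature
    has to be computed. *)

Require Import Defs.
From HB Require Import structures.
From mathcomp Require Import all_boot all_order all_algebra.
From mathcomp Require Import all_classical all_reals all_analysis.
From mathcomp Require Import complex.
From mathcomp Require Import ring lra.

Set Implicit Arguments.
Unset Strict Implicit.
Unset Printing Implicit Defensive.

Import Order.TTheory GRing.Theory Num.Theory.
Import numFieldNormedType.Exports.

Local Open Scope classical_set_scope.
Local Open Scope ring_scope.

(** * Smooth functions *)

(** By induction on k, the k-th derivative agrees on [I] with a member of [P]. As [I] is open, this
    is agreement near each point of [I], which transfers derivability and the value of the
    derivative. *)
Lemma smooth_on_line_coind (R : realType) (I : set R) (P : (R -> R) -> Prop) :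
  open I ->
  (forall u, P u -> exists2 v, P v & forall r, I r -> is_derive r 1 u (v r)) ->
  forall u, P u -> smooth_on_line I u.
Proof.
move=> Iopen Pstep u Pu k.
suff [v Pv uv] : exists2 v, P v & forall r, I r -> derive1n k u r = v r.
  have [dv _ vdv] := Pstep _ Pv; move=> r Ir.
  apply: near_eq_derivable (ex_derive (is_derive := vdv r Ir)).
  by apply: filterS (open_nbhs_nbhs (conj Iopen Ir)) => x /uv.
elim: k => [|k [v Pv uv]]; first by exists u.
have [dv Pdv vdv] := Pstep _ Pv; exists dv => // r Ir.
rewrite /= derive1E -(derive_val (is_derive := vdv r Ir)).
apply: near_eq_derive.
by apply: filterS (open_nbhs_nbhs (conj Iopen Ir)) => x /uv.
Qed.

Section SmoothLine.
Variables (R : realType) (I : set R).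
Hypothesis I_open : open I.
Implicit Types u v : R -> R.

Lemma smooth_on_line_is_derive u r :
  smooth_on_line I u -> I r -> is_derive r 1 u (derive1 u r).
Proof. by move=> su Ir; rewrite derive1E; apply/derivableP/(su 0%N). Qed.

Lemma smooth_on_line_derive1 u :
  smooth_on_line I u -> smooth_on_line I (derive1 u).
Proof. by move=> su k r Ir; rewrite /derive1n -iterSr; apply: (su k.+1). Qed.

Lemma smooth_on_line_cst c : smooth_on_line I (fun=> c).
Proof.
apply: (@smooth_on_line_coind _ _ (fun u => exists c, u = fun=> c)) => //;
  last by exists c.
move=> _ [d ->]; exists (fun=> 0); first by exists 0.
by move=> r _; apply: is_derive_cst.
Qed.

(* The closure of the smooth functions under the operations below is stable
   under differentiation, so that its members are smooth by coinduction. *)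
Inductive line_expr : (R -> R) -> Prop :=
| ExprSmooth u of smooth_on_line I u : line_expr u
| ExprD u v of line_expr u & line_expr v : line_expr (fun r => u r + v r)
| ExprM u v of line_expr u & line_expr v : line_expr (fun r => u r * v r)
| ExprV u of line_expr u & (forall r, I r -> u r != 0) :
    line_expr (fun r => (u r)^-1)
| ExprSqrt u of line_expr u & (forall r, I r -> 0 < u r) :
    line_expr (fun r => Num.sqrt (u r)).

Lemma line_expr_smooth u : line_expr u -> smooth_on_line I u.
Proof.
apply: smooth_on_line_coind u => // u.
elim=> {u} [u su|u v eu [du edu Du] ev [dv edv Dv]
  |u v eu [du edu Du] ev [dv edv Dv]|u eu [du edu Du] u0|u eu [du edu Du] u0].
- exists (derive1 u); first exact/ExprSmooth/smooth_on_line_derive1.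
  by move=> r Ir; apply: smooth_on_line_is_derive.
- exists (fun r => du r + dv r); first exact: ExprD.
  by move=> r Ir; have := is_deriveD (Du r Ir) (Dv r Ir).
- exists (fun r => u r * dv r + v r * du r); first by apply: ExprD; apply: ExprM.
  by move=> r Ir; have := is_deriveM (Du r Ir) (Dv r Ir).
(* The closure has no constructor for opposites or powers, hence the factor [-1] and the repeated
   inverse. *)
- exists (fun r => -1 * ((u r)^-1 * (u r)^-1) * du r).
    apply: ExprM => //; apply: ExprM; last by apply: ExprM; apply: ExprV.
    exact/ExprSmooth/smooth_on_line_cst.
  move=> r Ir; have Hu := Du r Ir; split.
    exact: derivableV (u0 r Ir) (ex_derive (is_derive := Hu)).
  rewrite (deriveV (u0 r Ir) (ex_derive (is_derive := Hu))).
  by rewrite (derive_val (is_derive := Hu)) /GRing.scale /= expr2 invfM mulN1r.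
- exists (fun r => (2 * Num.sqrt (u r))^-1 * du r).
    apply: ExprM => //; apply: ExprV => [|r Ir].
      apply: ExprM; last exact: ExprSqrt.
      exact/ExprSmooth/smooth_on_line_cst.
    by rewrite mulf_neq0 ?pnatr_eq0// gt_eqF// sqrtr_gt0 u0.
  move=> r Ir; apply: is_derive1_comp; last exact: Du.
  exact: is_derive1_sqrt (u0 r Ir).
Qed.

Lemma smooth_on_lineD u v : smooth_on_line I u -> smooth_on_line I v ->
  smooth_on_line I (fun r => u r + v r).
Proof.
by move=> su sv; apply: line_expr_smooth; apply: ExprD; apply: ExprSmooth.
Qed.

Lemma smooth_on_lineM u v : smooth_on_line I u -> smooth_on_line I v ->
  smooth_on_line I (fun r => u r * v r).
Proof.
by move=> su sv; apply: line_expr_smooth; apply: ExprM; apply: ExprSmooth.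
Qed.

Lemma smooth_on_line_sqr u :
  smooth_on_line I u -> smooth_on_line I (fun r => u r ^+ 2).
Proof. by move=> su; apply: (smooth_on_lineM su su). Qed.

Lemma smooth_on_lineN u : smooth_on_line I u -> smooth_on_line I (fun r => - u r).
Proof.
move=> su; rewrite (_ : (fun r => - u r) = (fun r => -1 * u r)).
  by apply: smooth_on_lineM => //; apply: smooth_on_line_cst.
by apply/funext => r; rewrite mulN1r.
Qed.

Lemma smooth_on_lineV u : (forall r, I r -> u r != 0) ->
  smooth_on_line I u -> smooth_on_line I (fun r => (u r)^-1).
Proof.
by move=> u0 su; apply: line_expr_smooth; apply: ExprV => //; apply: ExprSmooth.
Qed.

Lemma smooth_on_line_sqrt u : (forall r, I r -> 0 < u r) ->
  smooth_on_line I u -> smooth_on_line I (fun r => Num.sqrt (u r)).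
Proof.
by move=> u0 su; apply: line_expr_smooth; apply: ExprSqrt => //; apply: ExprSmooth.
Qed.

(** Coinduction needs a class stable under differentiation: the linear span of cos and sin is
    one. *)
Lemma smooth_on_line_cos_sin (a b : R) :
  smooth_on_line I (fun x => a * cos x + b * sin x).
Proof.
pose P u := exists a b : R, u = fun x => a * cos x + b * sin x.
apply: (@smooth_on_line_coind _ _ P) => //; last by exists a, b.
move=> _ [{}a [{}b ->]]; exists (fun x => b * cos x + (- a) * sin x).
  by exists b, (- a).
move=> r _; apply: is_derive_eq; rewrite /GRing.scale /=; ring.
Qed.

Lemma smooth_on_line_cos : smooth_on_line I cos.
Proof.
rewrite (_ : cos = fun x : R => 1 * cos x + 0 * sin x).
  exact: smooth_on_line_cos_sin.
by apply/funext => x; rewrite mul1r mul0r addr0.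
Qed.

Lemma smooth_on_line_sin : smooth_on_line I sin.
Proof.
rewrite (_ : sin = fun x : R => 0 * cos x + 1 * sin x).
  exact: smooth_on_line_cos_sin.
by apply/funext => x; rewrite mul1r mul0r add0r.
Qed.

End SmoothLine.

(** Along coordinate [i] the difference quotient is that of [u] when [i = j] and that of a constant
    otherwise. *)
Lemma is_derive_coord (R : realType) (n : nat) (i j : 'I_n) (u : R -> R) (du : R)
    (p : 'rV[R]_n) :
  is_derive (p 0 j) 1 u du ->
  is_derive p (delta_mx 0 i) (fun q => u (q 0 j)) ((i == j)%:R * du).
Proof.
case: (eqVneq i j) => [->|ij] udu /=.
  have E : (fun h : R => h^-1 *:
      (((fun q : 'rV[R]_n => u (q 0 j)) \o shift p) (h *: delta_mx 0 j) - u (p 0 j)))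
    = (fun h => h^-1 *: ((u \o shift (p 0 j)) (h *: 1) - u (p 0 j))).
    by apply/funext => h; rewrite /= !mxE !eqxx.
  split; first by rewrite /derivable E; exact: (ex_derive (is_derive := udu)).
  by rewrite /derive E mul1r; exact: (derive_val (is_derive := udu)).
have E : (fun h : R => h^-1 *:
    (((fun q : 'rV[R]_n => u (q 0 j)) \o shift p) (h *: delta_mx 0 i) - u (p 0 j)))
  = (fun h => h^-1 *:
    (((fun=> u (p 0 j)) \o shift p) (h *: delta_mx 0 i) - u (p 0 j))).
  by apply/funext => h; rewrite /= !mxE eqxx eq_sym (negPf ij) mulr0 add0r.
have D := is_derive_cst (u (p 0 j)) p (delta_mx 0 i : 'rV[R]_n).
split; first by rewrite /derivable E; exact: (ex_derive (is_derive := D)).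
by rewrite /derive E mul0r; exact: (derive_val (is_derive := D)).
Qed.

Lemma continuous_coord_comp (R : realType) (n : nat) (j : 'I_n) (u : R -> R)
    (p : 'rV[R]_n) :
  derivable u (p 0 j) 1 -> {for p, continuous (fun q : 'rV[R]_n => u (q 0 j))}.
Proof.
move=> /derivable1_diffP/differentiable_continuous uc.
by apply: continuous_comp => //; apply: coord_continuous.
Qed.

(** Since [j != k], a partial derivative acts on at most one factor. Hence the functions that agree
    on the open set with such a product form a class stable under [pderiv]. *)
Lemma smooth_on_coord_prod (R : realType) (n : nat) (j k : 'I_n) (J K : set R)
    (u v : R -> R) :
  j != k -> open J -> open K -> smooth_on_line J u -> smooth_on_line K v ->
  smooth_on [set p : 'rV[R]_n | J (p 0 j) /\ K (p 0 k)]
    (fun p => u (p 0 j) * v (p 0 k)).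
Proof.
move=> jk Jo Ko su sv; set U := mkset _.
have nbhsU p : U p -> nbhs p U.
  case=> Jp Kp.
  have HJ : nbhs p [set q : 'rV[R]_n | J (q 0 j)].
    exact: (@coord_continuous _ _ _ 0 j p _ (open_nbhs_nbhs (conj Jo Jp))).
  have HK : nbhs p [set q : 'rV[R]_n | K (q 0 k)].
    exact: (@coord_continuous _ _ _ 0 k p _ (open_nbhs_nbhs (conj Ko Kp))).
  by apply: filterS2 HJ HK.
pose P (h : 'rV[R]_n -> R) := exists u v : R -> R,
  [/\ smooth_on_line J u, smooth_on_line K v &
      forall p, U p -> h p = u (p 0 j) * v (p 0 k)].
have PD h p : P h -> U p ->
    {for p, continuous h} /\ forall i, derivable h p (delta_mx 0 i).
  move=> [{su}u [{sv}v [su sv huv]]] Up; have [Jp Kp] := Up.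
  have near_h : nbhs p [set q : 'rV[R]_n | u (q 0 j) * v (q 0 k) = h q].
    by apply: filterS (nbhsU p Up) => q /huv.
  split=> [|i].
    rewrite /prop_for /continuous_at (huv p Up).
    apply: cvg_trans (near_eq_cvg near_h) _.
    apply: (@cvgM _ _ (nbhs p)) => //.
      exact: (continuous_coord_comp (su 0%N _ Jp)).
    exact: (continuous_coord_comp (sv 0%N _ Kp)).
  apply: near_eq_derivable near_h _.
  have Du := is_derive_coord i (smooth_on_line_is_derive su Jp).
  have Dv := is_derive_coord i (smooth_on_line_is_derive sv Kp).
  exact: (ex_derive (is_derive := is_deriveM Du Dv)).
have Ppd h i : P h -> P (pderiv i h).
  move=> [{su}u [{sv}v [su sv huv]]].
  have E p : U p -> pderiv i h p
      = (i == j)%:R * (derive1 u (p 0 j) * v (p 0 k))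
        + (i == k)%:R * (u (p 0 j) * derive1 v (p 0 k)).
    move=> Up; have [Jp Kp] := Up.
    rewrite /pderiv (@near_eq_derive _ _ _ h (fun q => u (q 0 j) * v (q 0 k))).
    have Du := is_derive_coord i (smooth_on_line_is_derive su Jp).
    have Dv := is_derive_coord i (smooth_on_line_is_derive sv Kp).
    rewrite (derive_val (is_derive := is_deriveM Du Dv)) /GRing.scale /=; ring.
    by apply: filterS (nbhsU p Up) => q /huv.
  have [ij|ij] := eqVneq i j.
    exists (derive1 u), v; split=> // [|p Up]; first exact: smooth_on_line_derive1.
    by rewrite E// ij eqxx (negPf jk) mul1r mul0r addr0.
  (* Here [i] may also differ from [k]; the Kronecker factor then makes the product zero. *)
  exists u, (fun x => (i == k)%:R * derive1 v x); split=> // [|p Up].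
    apply: smooth_on_lineM => //; first exact: smooth_on_line_cst.
    exact: smooth_on_line_derive1.
  by rewrite E// (negPf ij) mul0r add0r mulrCA.
move=> s p; apply: PD.
elim: s => [|i s IHs] /=; last exact: Ppd.
by exists u, v; split.
Qed.

(** * The field strength *)

Section FieldStrength.
Variables (R : realType) (a0 aphi : R -> R) (p : 'rV[R]_5).
Hypothesis a0_derivable : derivable a0 (cR p) 1.
Hypothesis aphi_derivable : derivable aphi (cR p) 1.
Let s := sin (ctheta p).
Let c := cos (ctheta p).

(** The 1-form whose wedge product with dR is the electric part of F. *)
Definition radial_form : 'rV[R]_5 := derive1 a0 (cR p) *: dt R
  + derive1 aphi (cR p) *: (s ^+ 2 *: dphi R + c ^+ 2 *: dpsi R).

(** The potential depends on R and theta only, so its Jacobian matrix is a sum of two rank-one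
    terms, which [ext_deriv] then antisymmetrizes. *)
Lemma is_derive_potential (i j : 'I_5) :
  is_derive p (delta_mx 0 i) (fun q => potential a0 aphi q 0 j)
    (dR R 0 i * radial_form 0 j
     + dtheta R 0 i * (2 * s * c * aphi (cR p) * (dphi R - dpsi R) 0 j)).
Proof.
have Da0 : is_derive (p 0 1) 1 a0 (derive1 a0 (cR p)).
  by rewrite derive1E; apply/derivableP.
have Dap : is_derive (p 0 1) 1 aphi (derive1 aphi (cR p)).
  by rewrite derive1E; apply/derivableP.
have Ds : is_derive (p 0 2) 1 (fun x : R => sin x ^+ 2) (2 * s * c).
  apply: is_derive_eq; rewrite /GRing.scale /= -/(ctheta p) -/s -/c; ring.
have Dc : is_derive (p 0 2) 1 (fun x : R => cos x ^+ 2) (- (2 * s * c)).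
  apply: is_derive_eq; rewrite /GRing.scale /= -/(ctheta p) -/s -/c; ring.
have E0 := is_derive_coord i Da0.
have Ep := is_derive_coord i Dap.
have Es := is_derive_coord i Ds.
have Ec := is_derive_coord i Dc.
have Cst (x : R) := is_derive_cst x p (delta_mx 0 i : 'rV[R]_5).
have D := is_deriveD (is_deriveM E0 (Cst (dt R 0 j))) (is_deriveM Ep
   (is_deriveD (is_deriveM Es (Cst (dphi R 0 j))) (is_deriveM Ec (Cst (dpsi R 0 j))))).
rewrite (_ : (fun q => _) = (fun q : 'rV[R]_5 => a0 (q 0 1) * dt R 0 j + aphi (q 0 1) *
   (sin (q 0 2) ^+ 2 * dphi R 0 j + cos (q 0 2) ^+ 2 * dpsi R 0 j))).
  apply: is_derive_eq.
  rewrite /GRing.scale !fctE /= /radial_form !mxE -/(ctheta p) -/(cR p) -/s -/c !eqxx /=.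
  ring.
by apply/funext => q; rewrite /potential !mxE.
Qed.

(** The coefficients are twice those of the wedge products because [asym] carries a factor 1/2. *)
Lemma field_strengthE : field_strength a0 aphi p =
  2 *: asym (dR R) radial_form
  + (4 * s * c * aphi (cR p)) *: asym (dtheta R) (dphi R - dpsi R).
Proof.
apply/matrixP => i j.
rewrite /field_strength /ext_deriv mxE /pderiv.
rewrite (derive_val (is_derive := is_derive_potential i j)).
rewrite (derive_val (is_derive := is_derive_potential j i)).
rewrite /asym.
move: radial_form => rf; move: (dphi R - dpsi R) => chi.
rewrite !mxE !big_ord_recl !big_ord0 !mxE; by field.
Qed.

End FieldStrength.

(** * Linear algebra in a null frame *)

(** Replaces an index by numerals, on which the entries of explicit matrices compute. *)
Lemma ord5_ind (P : 'I_5 -> Prop) :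
  P 0 -> P 1 -> P 2 -> P 3 -> P 4 -> forall i, P i.
Proof.
move=> P0 P1 P2 P3 P4 [[|[|[|[|[|//]]]]] Hi].
- by rewrite (_ : Ordinal Hi = 0) //; apply/val_inj.
- by rewrite (_ : Ordinal Hi = 1) //; apply/val_inj.
- by rewrite (_ : Ordinal Hi = 2) //; apply/val_inj.
- by rewrite (_ : Ordinal Hi = 3) //; apply/val_inj.
- by rewrite (_ : Ordinal Hi = 4) //; apply/val_inj.
Qed.

Lemma sum_ord5 (V : nmodType) (F : 'I_5 -> V) :
  \sum_i F i = F 0 + F 1 + F 2 + F 3 + F 4.
Proof.
rewrite !big_ord_recl big_ord0 addr0 !addrA.
by congr (_ + _ + _ + _ + _); congr F; apply/val_inj.
Qed.

(* Missing entries are 0. *)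
Definition mx5 (R : nmodType) (rows : seq (seq R)) : 'M[R]_5 :=
  \matrix_(i, j) (nth [::] rows i)`_j.

(** From [A *m P = P *m B] follows (X - A) P = P (X - B); taking determinants, the nonzero constant
    det P cancels. *)
Lemma char_poly_similar (K : fieldType) n (A B P : 'M[K]_n) :
  P \in unitmx -> A *m P = P *m B -> char_poly A = char_poly B.
Proof.
rewrite unitmxE unitfE => P0 AP.
have P0' : (\det (map_mx polyC P)) != 0 by rewrite det_map_mx polyC_eq0.
apply: (mulIf P0'); rewrite [RHS]mulrC /char_poly -!det_mulmx /char_poly_mx.
by rewrite mulmxBl mulmxBr scalar_mxC -!map_mxM AP.
Qed.

Lemma char_poly_tr (K : comNzRingType) n (A : 'M[K]_n) :
  char_poly A^T = char_poly A.
Proof.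
by rewrite /char_poly -det_tr /char_poly_mx linearB /= tr_scalar_mx map_trmx trmxK.
Qed.

Section Eval2.
Variables (R : realType) (n : nat).
Implicit Types (T g F : 'M[R]_n) (u v : 'cV[R]_n) (a b : 'rV[R]_n).

Lemma eval2D (T1 T2 : 'M[R]_n) u v : eval2 (T1 + T2) u v = eval2 T1 u v + eval2 T2 u v.
Proof. by rewrite /eval2 mulmxDr mulmxDl mxE. Qed.

Lemma eval2N T u v : eval2 (- T) u v = - eval2 T u v.
Proof. by rewrite /eval2 mulmxN mulNmx mxE. Qed.

Lemma eval2Z k T u v : eval2 (k *: T) u v = k * eval2 T u v.
Proof. by rewrite /eval2 -scalemxAr -scalemxAl mxE. Qed.

Lemma eval2Zl T k u v : eval2 T (k *: u) v = k * eval2 T u v.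
Proof. by rewrite /eval2 linearZ /= -!scalemxAl mxE. Qed.

Lemma eval2Zr T k u v : eval2 T u (k *: v) = k * eval2 T u v.
Proof. by rewrite /eval2 -scalemxAr mxE. Qed.

Lemma eval2_outer a b u v : eval2 (a^T *m b) u v = (a *m u) 0 0 * (b *m v) 0 0.
Proof.
by rewrite /eval2 mulmxA -trmx_mul -mulmxA mxE big_ord1 mxE.
Qed.

(** Written as a trace, the contraction can be moved to a frame by cyclicity. *)
Lemma contract2E g F :
  contract2 g F = \tr (F *m invmx g *m F^T *m (invmx g)^T).
Proof.
apply: eq_bigr => i _; rewrite mxE exchange_big /=; apply: eq_bigr => k _.
rewrite exchange_big /= mxE mulr_suml; apply: eq_bigr => l _.
rewrite !mxE !mulr_suml; by apply: eq_bigr => j _; ring.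
Qed.

Lemma contractE (G T : 'M[R]_n) : \sum_i \sum_j G i j * T i j = \tr (G *m T^T).
Proof.
by apply: eq_bigr => i _; rewrite mxE; apply: eq_bigr => j _; rewrite mxE.
Qed.

End Eval2.

(** * Tensors through their components in a null frame *)

Section Frame.
Variables (R : realType) (e : 'I_5 -> 'cV[R]_5) (g F : 'M[R]_5) (al be : R).

Definition frame_mx : 'M[R]_5 := \matrix_(i, j) e j i 0.
Let E := frame_mx.

Lemma frame_mxE T a b : (E^T *m T *m E) a b = eval2 T (e a) (e b).
Proof.
rewrite /eval2 [LHS]mxE [RHS]mxE; apply: eq_bigr => j _; congr (_ * _).
  by rewrite !mxE; apply: eq_bigr => i _; rewrite !mxE.
by rewrite mxE.
Qed.

Lemma col_frame_mx a : col a E = e a.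
Proof. by apply/matrixP => i j; rewrite ord1 !mxE. Qed.

(** For the pairs exempted here the factors [lam] and [lam^-1] cancel or are absent, so these
    components have boost weight zero. *)
Lemma type_D_blocks T :
  (forall a b : 'I_5,
     ~~ [|| (a == 0) && (b == 1), (a == 1) && (b == 0) | (2 <= a)%N && (2 <= b)%N] ->
     eval2 T (e a) (e b) = 0) ->
  type_D T e.
Proof.
move=> T0 a b /eqP Tab.
have : [|| (a == 0) && (b == 1), (a == 1) && (b == 0) | (2 <= a)%N && (2 <= b)%N].
  by apply: contraNT Tab => /T0/eqP.
move=> ab T' e' lam lam0; rewrite expr0z mul1r /boost.
case/or3P: ab => /andP[].
- by move=> /eqP -> /eqP -> /=; rewrite eval2Zl eval2Zr mulrA divff ?mul1r.
- by move=> /eqP -> /eqP -> /=; rewrite eval2Zl eval2Zr mulrA mulVf ?mul1r.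
- by move: a b {Tab}; elim/ord5_ind => //; elim/ord5_ind.
Qed.

Definition null_gram : 'M[R]_5 :=
  mx5 [:: [:: 0; 1]; [:: 1]; [:: 0; 0; 1]; [:: 0; 0; 0; 1]; [:: 0; 0; 0; 0; 1]].

(** The (l, n) entry is [- al] because lowering an index exchanges l and n: the covector of l is 1
    on n and 0 on l. *)
Definition field_gram : 'M[R]_5 :=
  mx5 [:: [:: 0; - al]; [:: al]; [::]; [:: 0; 0; 0; 0; - be]; [:: 0; 0; 0; be]].

Hypothesis e_null : forall a b, eval2 g (e a) (e b) = null_gram a b.
Hypothesis e_field : forall a b, eval2 F (e a) (e b) = field_gram a b.

Let eta := null_gram.
Let Phi := field_gram.

Lemma frame_gram : E^T *m g *m E = eta.
Proof. by apply/matrixP => a b; rewrite frame_mxE. Qed.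

Lemma frame_field : E^T *m F *m E = Phi.
Proof. by apply/matrixP => a b; rewrite frame_mxE. Qed.

Lemma null_gramK : eta *m eta = 1%:M.
Proof.
apply/matrixP; elim/ord5_ind; elim/ord5_ind; rewrite !mxE sum_ord5 !mxE /=; ring.
Qed.

Lemma null_gram_tr : eta^T = eta.
Proof. by apply/matrixP; elim/ord5_ind; elim/ord5_ind; rewrite !mxE. Qed.

Lemma frame_mx_unit : E \in unitmx.
Proof.
have : eta *m E^T *m g *m E = 1%:M by rewrite -null_gramK -frame_gram !mulmxA.
by move=> /mulmx1_unit[].
Qed.

(** The product [eta *m E^T *m g *m E] is the identity; moving [E] to the front exhibits a left
    inverse of [g]. *)
Lemma metric_inv : invmx g = E *m eta *m E^T /\ g \in unitmx.
Proof.
have : eta *m E^T *m g *m E = 1%:M by rewrite -null_gramK -frame_gram !mulmxA.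
move=> /mulmx1C; rewrite !mulmxA => Gg.
have [_ gu] := mulmx1_unit Gg; split=> //.
by rewrite -[RHS](mulmxK gu) Gg mul1mx.
Qed.

(** Reduces tensor identities to an entrywise comparison of frame components. *)
Lemma frame_mx_inj (A B : 'M[R]_5) : E^T *m A *m E = E^T *m B *m E -> A = B.
Proof.
move=> /(congr1 (mulmxr (invmx E))) /=; rewrite !mulmxK ?frame_mx_unit //.
by move=> /(congr1 (mulmx (invmx E^T))) /=; rewrite !mulKmx ?unitmx_tr ?frame_mx_unit.
Qed.

Lemma frame_flat a : flat g (e a) *m E = row a eta.
Proof.
apply: trmx_inj; rewrite trmx_mul trmxK mulmxA tr_row null_gram_tr.
by rewrite -frame_gram -col_frame_mx !colE !mulmxA.
Qed.


Lemma frame_outer (a b : 'rV[R]_5) :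
  E^T *m (a^T *m b) *m E = (a *m E)^T *m (b *m E).
Proof. by rewrite trmx_mul !mulmxA. Qed.

Lemma frame_asym a b :
  E^T *m asym (flat g (e a)) (flat g (e b)) *m E = asym (row a eta) (row b eta).
Proof.
by rewrite /asym -scalemxAr -scalemxAl mulmxBr mulmxBl !frame_outer !frame_flat.
Qed.

Lemma frame_sym a b :
  E^T *m sym (flat g (e a)) (flat g (e b)) *m E = sym (row a eta) (row b eta).
Proof.
by rewrite /sym -scalemxAr -scalemxAl mulmxDr mulmxDl !frame_outer !frame_flat.
Qed.

Lemma frame_sqr_form a :
  E^T *m sqr_form (flat g (e a)) *m E = sqr_form (row a eta).
Proof. by rewrite /sqr_form frame_outer frame_flat. Qed.

Lemma frame_null : null_frame g e.
Proof.
split; try by rewrite e_null mxE.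
- by elim/ord5_ind=> // _; rewrite !e_null !mxE.
- by elim/ord5_ind=> //; elim/ord5_ind=> // _ _; rewrite e_null mxE.
Qed.

(** A zero frame vector would give the Gram matrix a zero column, against its being an
    involution. *)
Lemma frame_neq0 a : e a != 0.
Proof.
apply/eqP => ea0; have /eqP := null_gramK.
apply/negP/eqP => /matrixP/(_ a a); rewrite [RHS]mxE eqxx mxE big1 => [/eqP|i _].
  by rewrite eq_sym oner_eq0.
by rewrite -[eta i a]e_null ea0 /eval2 mulmx0 [X in _ * X]mxE mulr0.
Qed.

Lemma frame_mixed : mixed g F *m E = E *m (eta *m Phi).
Proof. by rewrite /mixed (metric_inv).1 -frame_field !mulmxA. Qed.

(** The endomorphism has matrix [eta *m Phi] in the frame, and [eta] is its own inverse, so the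
    hypothesis says that this matrix multiplies the a-th basis vector by [lam]. *)
Lemma frame_eigenvector a lam :
  col a Phi = lam *: col a eta -> is_eigenvector (mixed g F) (e a) lam.
Proof.
move=> Pa; split; first exact: frame_neq0.
rewrite -col_frame_mx -/E colE mulmxA frame_mixed -!mulmxA -(colE a Phi) Pa.
by rewrite colE -!scalemxAr [eta *m (_ *m _)]mulmxA null_gramK mul1mx.
Qed.

Lemma frame_field_form : F = (2 * al) *: asym (flat g (e 0)) (flat g (e 1))
  - (2 * be) *: asym (flat g (e 3)) (flat g (e 4)).
Proof.
apply: frame_mx_inj; move: (frame_asym 0 1) (frame_asym 3 4).
move: (asym (flat _ _) _) (asym (flat _ _) _) => A B EA EB.
rewrite frame_field mulmxBr mulmxBl -!scalemxAr -!scalemxAl EA EB.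
apply/matrixP; elim/ord5_ind; elim/ord5_ind;
  rewrite !mxE !big_ord1 !mxE /=; by field.
Qed.

(** The common shape of the components of the metric (where all three parameters are 1), of the
    stress-energy tensor and of the Ricci tensor. *)
Definition diag_gram (x y z : R) : 'M[R]_5 :=
  mx5 [:: [:: 0; x]; [:: x]; [:: 0; 0; y]; [:: 0; 0; 0; z]; [:: 0; 0; 0; 0; z]].

Lemma type_D_diag_gram T x y z :
  E^T *m T *m E = diag_gram x y z -> type_D T e.
Proof.
move=> ET; apply: type_D_blocks => a b; rewrite -frame_mxE ET.
by elim/ord5_ind: a; elim/ord5_ind: b => // _; rewrite mxE.
Qed.

Lemma type_D_field : type_D F e.
Proof.
apply: type_D_blocks => a b; rewrite e_field.
by elim/ord5_ind: a; elim/ord5_ind: b => // _; rewrite mxE.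
Qed.

Lemma frame_stress_energy : E^T *m stress_energy g F *m E =
  diag_gram (- (al ^+ 2 + be ^+ 2) / 2) ((al ^+ 2 - be ^+ 2) / 2)
    ((al ^+ 2 + be ^+ 2) / 2).
Proof.
have EF : E^T *m (F *m invmx g *m F^T) *m E = Phi *m eta *m Phi^T.
  by rewrite (metric_inv).1 -frame_field !trmx_mul trmxK !mulmxA.
have PP : Phi *m eta *m Phi^T = diag_gram (- al ^+ 2) 0 (be ^+ 2).
  rewrite (_ : Phi *m eta = mx5 [:: [:: - al]; [:: 0; al]; [::]; [:: 0; 0; 0; 0; - be];
      [:: 0; 0; 0; be]]).
    apply/matrixP; elim/ord5_ind; elim/ord5_ind;
      rewrite !mxE sum_ord5 !mxE /=; ring.
  apply/matrixP; elim/ord5_ind; elim/ord5_ind;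
    rewrite !mxE sum_ord5 !mxE /=; ring.
(* The invariant is the [eta]-trace of the product just computed: each of [- al ^+ 2] and [be ^+ 2]
   is counted twice. *)
have cF : contract2 g F = 2 * (be ^+ 2 - al ^+ 2).
  rewrite contract2E (metric_inv).1 !trmx_mul trmxK null_gram_tr !mulmxA mxtrace_mulC.
  rewrite [X in \tr X](_ : _ = Phi *m eta *m Phi^T *m eta); last first.
    by rewrite -frame_field !trmx_mul trmxK !mulmxA.
  rewrite PP /mxtrace !(mxE, sum_ord5) /=; ring.
rewrite /stress_energy cF mulmxBr mulmxBl EF PP -scalemxAr -scalemxAl frame_gram.
apply/matrixP; elim/ord5_ind; elim/ord5_ind; rewrite !mxE /=; by field.
Qed.

Lemma frame_ricci (Ric : 'M[R]_5) :
  Ric - (2^-1 * \sum_i \sum_j invmx g i j * Ric i j) *: g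
    = 2 *: stress_energy g F ->
  E^T *m Ric *m E = diag_gram (- (2 / 3) * (2 * al ^+ 2 + be ^+ 2))
    (2 / 3 * (al ^+ 2 - be ^+ 2)) (2 / 3 * (al ^+ 2 + 2 * be ^+ 2)).
Proof.
rewrite contractE; set S := \tr _ => /(congr1 (fun A => E^T *m A *m E)).
move: frame_stress_energy; move: (stress_energy g F) => T ET.
rewrite mulmxBr mulmxBl -!scalemxAr -!scalemxAl ET frame_gram.
move=> /(canRL (subrK _)).
set rho := E^T *m Ric *m E => Erho.
have ES : S = \tr (eta *m rho^T).
  rewrite /S (metric_inv).1 -!mulmxA mxtrace_mulC /rho !trmx_mul trmxK.
  by rewrite -!mulmxA.
(* This is the trace of the equation: the metric has trace 5 and [2 *: T] has trace
   [al ^+ 2 - be ^+ 2]. It is linear in [S] and determines it. *)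
have {ES} S_eq : S = 5 / 2 * S + (al ^+ 2 - be ^+ 2).
  by rewrite {1}ES Erho /mxtrace !(mxE, sum_ord5) /=; field.
rewrite Erho (_ : 2^-1 * S = - (al ^+ 2 - be ^+ 2) / 3); last by lra.
apply/matrixP; elim/ord5_ind; elim/ord5_ind; rewrite !mxE /=; by field.
Qed.

Lemma frame_diag_form (T : 'M[R]_5) x y z :
  E^T *m T *m E = diag_gram x y z ->
  T = (2 * x) *: sym (flat g (e 0)) (flat g (e 1)) + y *: sqr_form (flat g (e 2))
    + z *: (sqr_form (flat g (e 3)) + sqr_form (flat g (e 4))).
Proof.
move=> ET; apply: frame_mx_inj; rewrite ET.
move: (frame_sym 0 1) (frame_sqr_form 2) (frame_sqr_form 3) (frame_sqr_form 4).
move: (sym _ _) (sqr_form (flat _ _)) (sqr_form (flat _ _)) (sqr_form (flat _ _)).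
move=> A B C D EA EB EC ED; rewrite !mulmxDr !mulmxDl -!scalemxAr -!scalemxAl.
rewrite mulmxDr mulmxDl EA EB EC ED.
apply/matrixP; elim/ord5_ind; elim/ord5_ind;
  rewrite !mxE !big_ord1 !mxE /=; by field.
Qed.

Lemma frame_decomp v : exists x : 'cV[R]_5,
  v = E *m x /\ forall T, eval2 T v v = eval2 (E^T *m T *m E) x x.
Proof.
exists (invmx E *m v); rewrite mulKVmx ?frame_mx_unit//; split=> // T.
by rewrite -{1 2}[v](mulKVmx frame_mx_unit) /eval2 !trmx_mul !mulmxA.
Qed.

Lemma eval2_diag_gram x y z (u : 'cV[R]_5) : eval2 (diag_gram x y z) u u =
  2 * x * (u 0 0 * u 1 0) + y * u 2 0 ^+ 2 + z * (u 3 0 ^+ 2 + u 4 0 ^+ 2).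
Proof. rewrite /eval2 !(mxE, sum_ord5) /=; ring. Qed.

(** Subtracting x times the null condition from T(v, v) leaves a combination of the squares of the
    last three components with positive coefficients [y - x] and [z - x]. If it vanishes, so do
    these components, and the null condition makes the product of the first two zero. *)
Lemma frame_null_vectors (T : 'M[R]_5) x y z (v : 'cV[R]_5) :
  E^T *m T *m E = diag_gram x y z -> x < y -> x < z ->
  v != 0 -> eval2 g v v = 0 ->
  (eval2 T v v = 0 <-> exists c, v = c *: e 0 \/ v = c *: e 1).
Proof.
move=> ET xy xz v0; have [u [vE evE]] := frame_decomp v.
rewrite !evE ET frame_gram (_ : eta = diag_gram 1 1 1)// !eval2_diag_gram => gv.
have {}vE : v = u 0 0 *: e 0 + u 1 0 *: e 1 + u 2 0 *: e 2 + u 3 0 *: e 3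
    + u 4 0 *: e 4.
  rewrite vE; apply/matrixP => i j; rewrite ord1 !(mxE, sum_ord5) /=; ring.
split=> [Tv|[c vc]].
  have h2 := sqr_ge0 (u 2 0); have h3 := sqr_ge0 (u 3 0); have h4 := sqr_ge0 (u 4 0).
  have u01 : 2 * (u 0 0 * u 1 0) = - (u 2 0 ^+ 2 + u 3 0 ^+ 2 + u 4 0 ^+ 2) by lra.
  have Q : (y - x) * u 2 0 ^+ 2 + ((z - x) * u 3 0 ^+ 2 + (z - x) * u 4 0 ^+ 2) = 0.
    rewrite -[RHS]Tv (_ : 2 * x * _ = x * (2 * (u 0 0 * u 1 0))); last by ring.
    by rewrite u01; ring.
  have yx : 0 < y - x by lra.
  have zx : 0 < z - x by lra.
  have : u 2 0 ^+ 2 = 0 /\ u 3 0 ^+ 2 = 0 /\ u 4 0 ^+ 2 = 0.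
    by split; [|split]; apply/eqP; rewrite eq_le sqr_ge0 andbT; nra.
  move=> [/eqP]; rewrite sqrf_eq0 => /eqP u2 [/eqP].
  rewrite sqrf_eq0 => /eqP u3 /eqP; rewrite sqrf_eq0 => /eqP u4.
  have : u 0 0 * u 1 0 = 0 by move: u01; rewrite u2 u3 u4; lra.
  move: vE; rewrite u2 u3 u4 !scale0r !addr0 => -> /eqP.
  rewrite mulf_eq0 => /orP[/eqP ->|/eqP ->].
    by exists (u 1 0); right; rewrite scale0r add0r.
  by exists (u 0 0); left; rewrite scale0r addr0.
(* Conversely, the two leading diagonal entries of [diag_gram] are 0. *)
rewrite -eval2_diag_gram -ET -evE.
by case: vc => ->; rewrite eval2Zl eval2Zr -frame_mxE ET mxE !mulr0.
Qed.

End Frame.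

(** * The spectrum of the field strength *)

Section Spectrum.
Variables (R : realType) (e : 'I_5 -> 'cV[R]_5) (g F : 'M[R]_5) (al be : R).
Hypothesis e_null : forall a b, eval2 g (e a) (e b) = null_gram R a b.
Hypothesis e_field : forall a b, eval2 F (e a) (e b) = field_gram al be a b.

Let rc := @real_complex R.
Let spectrum : seq (complex R) :=
  [:: 0; Complex al 0; Complex (- al) 0; Complex 0 be; Complex 0 (- be)].
Let im : complex R := Complex 0 1.
Let im2 : im * im = -1.
Proof. by apply/eqP; rewrite eq_complex /= !mul0r mulr1 mulr0 addr0 sub0r oppr0 !eqxx. Qed.

(* In the frame the field strength acts by al, -al on l, n, by 0 on m_(2) and
   rotates the plane of m_(3), m_(4); the columns are the eigenvectors
   m_(2), l, n, m_(3) - i m_(4), m_(3) + i m_(4). *)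
Let C : 'M[complex R]_5 :=
  mx5 [:: [:: 0; 1]; [:: 0; 0; 1]; [:: 1]; [:: 0; 0; 0; 1; 1]; [:: 0; 0; 0; - im; im]].
Let C' : 'M[complex R]_5 :=
  mx5 [:: [:: 0; 0; 1]; [:: 1]; [:: 0; 1];
          [:: 0; 0; 0; 2^-1; im / 2]; [:: 0; 0; 0; 2^-1; - im / 2]].
Let D : 'M[complex R]_5 := diag_mx (\row_i spectrum`_i).

Let C_unit : C \in unitmx.
Proof.
have /mulmx1_unit[] // : C *m C' = 1%:M.
apply/matrixP; elim/ord5_ind; elim/ord5_ind; rewrite !mxE sum_ord5 !mxE /=; by field: im2.
Qed.

Let eta_Phi : null_gram R *m field_gram al be = mx5 [:: [:: al]; [:: 0; - al]; [::];
  [:: 0; 0; 0; 0; - be]; [:: 0; 0; 0; be]].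
Proof.
apply/matrixP; elim/ord5_ind; elim/ord5_ind; rewrite !mxE sum_ord5 !mxE /=; ring.
Qed.

Let C_diag : map_mx rc (null_gram R *m field_gram al be) *m C = C *m D.
Proof.
have rcN x : rc (- x) = - rc x by exact: rmorphN.
have rc0 : rc 0 = 0 by [].
(* All complex entries are expressed through [rc] and [im], so that [ring] can decide the identities
   modulo [im2]. *)
have E1 x : Complex x 0 = rc x by [].
have E2 x : Complex 0 x = im * rc x.
  by apply/eqP; rewrite eq_complex /=; apply/andP; split; apply/eqP; ring.
rewrite eta_Phi /D /spectrum !E1 !E2 !rcN.
apply/matrixP; elim/ord5_ind; elim/ord5_ind;
  rewrite !mxE !sum_ord5 !mxE /= ?rcN ?rc0; ring: im2.
Qed.

(** The frame matrix followed by [C] conjugates the endomorphism to the diagonal matrix [D]. *)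
Lemma frame_char_poly :
  char_poly (map_mx rc (mixed g F)) = \prod_(z <- spectrum) ('X - z%:P).
Proof.
rewrite (@char_poly_similar _ _ _ D (map_mx rc (frame_mx e) *m C)).
- rewrite char_poly_trig ?diag_mx_is_trig// [RHS](big_nth 0) big_mkord.
  by apply: eq_bigr => i _; rewrite !mxE eqxx mulr1n.
- by rewrite unitmx_mul C_unit map_unitmx (frame_mx_unit e_null).
- rewrite mulmxA -map_mxM (frame_mixed e_null e_field) map_mxM -!mulmxA.
  by rewrite C_diag.
Qed.

Lemma frame_eigenvalue z :
  eigenvalue (map_mx rc (mixed g F))^T z <-> z \in spectrum.
Proof.
by rewrite eigenvalue_root_char char_poly_tr frame_char_poly root_prod_XsubC.
Qed.

End Spectrum.

(** * The frame of the ansatz *)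

Section CovectorEval.
Variables (R : realType) (n : nat).
Implicit Types (a b : 'rV[R]_n) (u : 'cV[R]_n).

Lemma covectorD a b u : ((a + b) *m u) 0 0 = (a *m u) 0 0 + (b *m u) 0 0.
Proof. by rewrite mulmxDl mxE. Qed.

Lemma covectorN a u : ((- a) *m u) 0 0 = - (a *m u) 0 0.
Proof. by rewrite mulNmx mxE. Qed.

Lemma covectorZ k a u : ((k *: a) *m u) 0 0 = k * (a *m u) 0 0.
Proof. by rewrite -scalemxAl mxE. Qed.

Lemma covector_delta i u : ((delta_mx 0 i : 'rV[R]_n) *m u) 0 0 = u i 0.
Proof. by rewrite -rowE mxE. Qed.

End CovectorEval.

Lemma open_quadrant (R : realType) : open [set t : R | 0 < t < pi / 2].
Proof.
by rewrite (_ : mkset _ = `]0, pi / 2[%classic) ?set_itvoo//; exact: itv_open.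
Qed.

Lemma sin_neq0_quadrant (R : realType) (t : R) : 0 < t < pi / 2 -> sin t != 0.
Proof.
move=> /andP[t0 t1]; rewrite gt_eqF// sin_gt0_pi// t0 /=.
by have := @pi_gt0 R; lra.
Qed.

Lemma cos_neq0_quadrant (R : realType) (t : R) : 0 < t < pi / 2 -> cos t != 0.
Proof.
move=> /andP[t0 t1]; rewrite gt_eqF// cos_gt0_pihalf// t1 andbT.
by have := @pi_gt0 R; lra.
Qed.

Section AnsatzFrame.
Variables (R : realType) (f m N w a0 aphi : R -> R).
Implicit Types p : 'rV[R]_5.

Let A r : R := Num.sqrt (alpha_radicand f m N w a0 aphi r).
Let K r : R := Num.sqrt (m r / f r).

(* Let omega = a0' dt + aphi' sigma with sigma = sin^2 dphi + cos^2 dpsi.  The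
   electric part of F is dR /\ omega, and the square of omega is - m q^2 / (f N).
   The 1-forms of l and n are the null combinations dR / 2 -+ f N / (m q) omega,
   the second one boosted by m / (2 f N); m_(2) completes omega in the plane of
   dt and sigma, and m_(3), m_(4) span the plane of dphi - dpsi and dtheta. *)
Definition frame_rows (f m N w x y q k s c : R) : seq (seq R) :=
  let X := x + w * y in
  [:: [:: N * X / (m * q); 2 * f * N / m; 0;
          w * (N * X / (m * q)) - f * y / q; w * (N * X / (m * q)) - f * y / q];
      [:: - X / (2 * q * f); 1; 0;
          - (w * X) / (2 * q * f) + m * y / (2 * q * N);
          - (w * X) / (2 * q * f) + m * y / (2 * q * N)];
      [:: - y / q; 0; 0; x / q; x / q];
      [:: 0; 0; 0; k^-1 * (c / s); - k^-1 * (s / c)];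
      [:: 0; 0; k^-1]].

(** The parameter [q] of the rows becomes half of [alpha], and [k] the length of the theta
    coordinate vector. *)
Definition ansatz_frame p (a : 'I_5) : 'cV[R]_5 :=
  let r := cR p in
  \col_mu (nth [::] (frame_rows (f r) (m r) (N r) (w r) (derive1 a0 r)
    (derive1 aphi r) (A r) (K r) (sin (ctheta p)) (cos (ctheta p))) a)`_mu.

Lemma eval2_metric p (u v : 'cV[R]_5) :
  let r := cR p in let s := sin (ctheta p) in let c := cos (ctheta p) in
  eval2 (metric f m N w p) u v =
  - f r * (u 0 0 * v 0 0)
  + m r / f r * ((4 * N r)^-1 * (u 1 0 * v 1 0) + u 2 0 * v 2 0)
  + N r / m r * (s ^+ 2 * ((u 3 0 - w r * u 0 0) * (v 3 0 - w r * v 0 0))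
                 + c ^+ 2 * ((u 4 0 - w r * u 0 0) * (v 4 0 - w r * v 0 0)))
  + (m r ^+ 2 - f r * N r) / (m r * f r) * s ^+ 2 * c ^+ 2
    * ((u 3 0 - u 4 0) * (v 3 0 - v 4 0)).
Proof.
rewrite /metric !(eval2D, eval2Z, eval2_outer) /=.
by rewrite !(covectorD, covectorN, covectorZ, covector_delta).
Qed.

Lemma eval2_field_strength p (u v : 'cV[R]_5) :
  derivable a0 (cR p) 1 -> derivable aphi (cR p) 1 ->
  let r := cR p in let s := sin (ctheta p) in let c := cos (ctheta p) in
  let radial (x : 'cV[R]_5) := derive1 a0 r * x 0 0
    + derive1 aphi r * (s ^+ 2 * x 3 0 + c ^+ 2 * x 4 0) in
  eval2 (field_strength a0 aphi p) u v =
  u 1 0 * radial v - radial u * v 1 0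
  + 2 * s * c * aphi r * (u 2 0 * (v 3 0 - v 4 0) - (u 3 0 - u 4 0) * v 2 0).
Proof.
move=> Da Dp r s c radial; rewrite field_strengthE// /asym.
rewrite !(eval2D, eval2Z, eval2N, eval2_outer) /radial_form.
rewrite !(covectorD, covectorN, covectorZ, covector_delta) -/r -/s -/c.
by rewrite /radial; field.
Qed.

Section AtPoint.
Variable p : 'rV[R]_5.
Hypothesis f_gt0 : 0 < f (cR p).
Hypothesis m_gt0 : 0 < m (cR p).
Hypothesis N_gt0 : 0 < N (cR p).
Hypothesis rad_gt0 : 0 < alpha_radicand f m N w a0 aphi (cR p).
Hypothesis theta_bound : 0 < ctheta p < pi / 2.

(** Each entry is a rational identity modulo the values of [q ^+ 2] and of cos squared. The two Gram
    matrices are treated together to share the elimination. *)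
Lemma ansatz_frame_gram a b :
  derivable a0 (cR p) 1 -> derivable aphi (cR p) 1 ->
  eval2 (metric f m N w p) (ansatz_frame p a) (ansatz_frame p b)
    = null_gram R a b /\
  eval2 (field_strength a0 aphi p) (ansatz_frame p a) (ansatz_frame p b)
    = field_gram (alpha f m N w a0 aphi (cR p)) (beta f m aphi (cR p)) a b.
Proof.
move=> Da0 Daphi; rewrite eval2_metric eval2_field_strength//.
have s0 := sin_neq0_quadrant theta_bound; have c0 := cos_neq0_quadrant theta_bound.
have A0 : A (cR p) != 0 by rewrite gt_eqF// sqrtr_gt0.
have A2 := sqr_sqrtr (ltW rad_gt0); rewrite -/(A _) in A2.
have K0 : K (cR p) != 0 by rewrite gt_eqF// sqrtr_gt0 divr_gt0.
have K2 : K (cR p) ^+ 2 = m (cR p) / f (cR p) by rewrite sqr_sqrtr// ltW// divr_gt0.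
have sc : cos (ctheta p) ^+ 2 = 1 - sin (ctheta p) ^+ 2.
  by rewrite -(cos2Dsin2 (ctheta p)) addrK.
have f_neq0 := lt0r_neq0 f_gt0; have m_neq0 := lt0r_neq0 m_gt0.
have N_neq0 := lt0r_neq0 N_gt0.
(* m and N are eliminated in favour of k and h = N / m, so that the relations
   left are polynomial rewriting rules for the squares of q and cos. *)
have mE : m (cR p) = K (cR p) ^+ 2 * f (cR p) by rewrite K2 divfK.
have [h hE] : exists h, N (cR p) / m (cR p) = h by exists (N (cR p) / m (cR p)).
have h_neq0 : h != 0 by rewrite -hE mulf_neq0// invr_eq0.
have NE : N (cR p) = h * (K (cR p) ^+ 2 * f (cR p)) by rewrite -mE -hE divfK.
move: A2; rewrite /alpha /ansatz_frame /beta -/(A _).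
rewrite {1}/alpha_radicand hE NE mE.
move: s0 c0 A0 K0 sc h_neq0 f_neq0 => {NE mE hE K2}.
move: (sin _) (cos _) (A _) (K _) (derive1 a0 _) (derive1 aphi _) (w _) (aphi _).
move: (f _) h => f1 h s c q k x y v z.
clear => s_neq0 c_neq0 q_neq0 k_neq0 c2 h_neq0 f_neq0 q2; rewrite /frame_rows.
split; elim/ord5_ind: a; elim/ord5_ind: b; rewrite !mxE /=.
all: by field: q2 c2;
  rewrite ?s_neq0 ?c_neq0 ?q_neq0 ?k_neq0 ?h_neq0 ?f_neq0 ?pnatr_eq0.
Qed.

End AtPoint.

End AnsatzFrame.

(** * Smoothness of the frame on the chart *)

Section FrameSmooth.
Variables (R : realType) (I : set R) (f m N w a0 aphi : R -> R).
Hypothesis I_open : open I.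
Hypothesis f_smooth : smooth_on_line I f.
Hypothesis m_smooth : smooth_on_line I m.
Hypothesis N_smooth : smooth_on_line I N.
Hypothesis w_smooth : smooth_on_line I w.
Hypothesis a0_smooth : smooth_on_line I a0.
Hypothesis aphi_smooth : smooth_on_line I aphi.
Hypothesis f_gt0 : forall r, I r -> 0 < f r.
Hypothesis m_gt0 : forall r, I r -> 0 < m r.
Hypothesis N_gt0 : forall r, I r -> 0 < N r.
Hypothesis rad_gt0 : forall r, I r -> 0 < alpha_radicand f m N w a0 aphi r.

Lemma smooth_on_chart u v (h : 'rV[R]_5 -> R) :
  smooth_on_line I u -> smooth_on_line [set t : R | 0 < t < pi / 2] v ->
  h = (fun p => u (cR p) * v (ctheta p)) -> smooth_on (chart I) h.
Proof.
move=> su sv ->; exact: (smooth_on_coord_prod _ I_open (@open_quadrant R) su sv).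
Qed.

(** Follows the syntax of the function and leaves the nonvanishing of denominators as goals. *)
Ltac smooth_line := repeat match goal with
  | H : smooth_on_line _ ?u |- smooth_on_line _ ?u => exact H
  | H : smooth_on_line _ ?u |- smooth_on_line _ (fun r => ?u r) => exact H
  | |- smooth_on_line _ (fun=> ?c) => apply: smooth_on_line_cst
  | |- smooth_on_line _ (fun r => derive1 ?u r) =>
      apply: (@smooth_on_line_derive1 _ _ u)
  | |- smooth_on_line _ (fun r => @?u r ^+ 2) => apply: (@smooth_on_line_sqr _ _ _ u)
  | |- smooth_on_line _ (fun r => @?u r * @?v r) =>
      apply: (@smooth_on_lineM _ _ _ u v)
  | |- smooth_on_line _ (fun r => @?u r + @?v r) =>
      apply: (@smooth_on_lineD _ _ _ u v)
  | |- smooth_on_line _ (fun r => - @?u r) => apply: (@smooth_on_lineN _ _ _ u)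
  | |- smooth_on_line _ (fun r => (@?u r)^-1) => apply: (@smooth_on_lineV _ _ _ u)
  | H : open ?J |- open ?J => exact H
  end.

Lemma smooth_alpha_radicand : smooth_on_line I (alpha_radicand f m N w a0 aphi).
Proof.
rewrite /alpha_radicand; smooth_line; by move=> r /m_gt0 /lt0r_neq0.
Qed.

(** Each component is a function of R times a function of theta; only m_(3) has a nonconstant second
    factor. *)
Lemma smooth_ansatz_frame (a mu : 'I_5) :
  smooth_on (chart I) (fun p => ansatz_frame f m N w a0 aphi p a mu 0).
Proof.
pose q r := Num.sqrt (alpha_radicand f m N w a0 aphi r).
pose k r := Num.sqrt (m r / f r).
have f0 r : I r -> f r != 0 by move=> /f_gt0 /lt0r_neq0.
have m0 r : I r -> m r != 0 by move=> /m_gt0 /lt0r_neq0.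
have N0 r : I r -> N r != 0 by move=> /N_gt0 /lt0r_neq0.
have q0 r : I r -> q r != 0 by move=> Ir; rewrite gt_eqF// sqrtr_gt0 rad_gt0.
have k0 r : I r -> k r != 0.
  by move=> Ir; rewrite gt_eqF// sqrtr_gt0 divr_gt0 ?f_gt0 ?m_gt0.
have q_smooth : smooth_on_line I q.
  exact: (smooth_on_line_sqrt I_open rad_gt0 smooth_alpha_radicand).
have k_smooth : smooth_on_line I k.
  apply: (smooth_on_line_sqrt I_open) => [r Ir|]; first by rewrite divr_gt0 ?f_gt0 ?m_gt0.
  by smooth_line.
(* Setting sin and cos to 1 in the rows isolates the radial factor, and [v] restores the quotients.
   For m_(3) the value of [v] off the phi and psi components is immaterial, as [u] is 0 there. *)
pose u r := (nth [::] (frame_rows (f r) (m r) (N r) (w r) (derive1 a0 r)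
  (derive1 aphi r) (q r) (k r) 1 1) a)`_mu.
pose v (t : R) := if a != 3 then 1 else if mu == 3 then cos t / sin t else sin t / cos t.
apply: (@smooth_on_chart u v).
- rewrite /u /frame_rows; elim/ord5_ind: a {u v}; elim/ord5_ind: mu;
    rewrite /=; smooth_line; move=> r Ir;
    rewrite ?mulf_neq0 ?q0 ?m0 ?N0 ?k0 ?f0 ?oner_neq0 ?pnatr_eq0 //.
- have J_open := @open_quadrant R.
  have s0 := @sin_neq0_quadrant R; have c0 := @cos_neq0_quadrant R.
  rewrite /v; case: (a != 3); first exact: (smooth_on_line_cst J_open).
  have cos_smooth := smooth_on_line_cos J_open.
  have sin_smooth := smooth_on_line_sin J_open.
  by case: (mu == 3); smooth_line.
- apply/funext => p; rewrite /u /v /ansatz_frame /frame_rows -/(q _) -/(k _) {u v}.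
  by elim/ord5_ind: a; elim/ord5_ind: mu; rewrite !mxE /= ?divr1 ?mulr1 ?mul0r.
Qed.

End FrameSmooth.

Theorem mainTheorem5 (R : realType) (I : set R) (f m N w a0 aphi : R -> R)
  (I_open : open I) (I_interval : is_interval I)
  (f_smooth : smooth_on_line I f) (m_smooth : smooth_on_line I m)
  (N_smooth : smooth_on_line I N) (w_smooth : smooth_on_line I w)
  (a0_smooth : smooth_on_line I a0) (aphi_smooth : smooth_on_line I aphi)
  (f_gt0 : forall r, I r -> 0 < f r) (m_gt0 : forall r, I r -> 0 < m r)
  (N_gt0 : forall r, I r -> 0 < N r)
  (radicand_gt0 : forall r, I r -> 0 < alpha_radicand f m N w a0 aphi r) :
  let U := chart I in
  let g := metric f m N w in
  let F := field_strength a0 aphi in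
  let T := fun p => stress_energy (g p) (F p) in
  let al := fun p => alpha f m N w a0 aphi (cR p) in
  let be := fun p => beta f m aphi (cR p) in
  (* The eigenvalues over the complex numbers, as a set and with algebraic
     multiplicity. The library's eigenvalue is for M acting by v |-> v *m M on
     row vectors, whence the transpose. *)
  (forall p, U p ->
     let M := map_mx (@real_complex R) (mixed (g p) (F p)) in
     let spectrum := [:: 0; Complex (al p) 0; Complex (- al p) 0;
                         Complex 0 (be p); Complex 0 (- be p)] in
     (forall z : complex R, eigenvalue M^T z <-> z \in spectrum) /\
     char_poly M = \prod_(z <- spectrum) ('X - z%:P)) /\
  exists e : 'rV[R]_5 -> 'I_5 -> 'cV[R]_5,
    let ell := fun p => e p 0 in
    let n := fun p => e p 1 in
    let m2 := fun p => e p 2 in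
    let m3 := fun p => e p 3 in
    let m4 := fun p => e p 4 in
    (forall (a mu : 'I_5), smooth_on U (fun p => e p a mu 0)) /\
    (forall p, U p ->
       [/\ null_frame (g p) (e p),
           [/\ is_eigenvector (mixed (g p) (F p)) (ell p) (al p),
               is_eigenvector (mixed (g p) (F p)) (n p) (- al p) &
               is_eigenvector (mixed (g p) (F p)) (m2 p) 0],
           F p = (2 * al p) *: asym (flat (g p) (ell p)) (flat (g p) (n p))
                 - (2 * be p) *: asym (flat (g p) (m3 p)) (flat (g p) (m4 p)),
           type_D (F p) (e p) &
           type_D (T p) (e p)]) /\
    (einstein_equations f m N w a0 aphi U ->
     forall p, U p ->
       [/\ ricci g p =
             (- (4 / 3) * (2 * al p ^+ 2 + be p ^+ 2))
               *: sym (flat (g p) (ell p)) (flat (g p) (n p))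
             + (2 / 3 * (al p ^+ 2 - be p ^+ 2))
               *: sqr_form (flat (g p) (m2 p))
             + (2 / 3 * (al p ^+ 2 + 2 * be p ^+ 2))
               *: (sqr_form (flat (g p) (m3 p)) + sqr_form (flat (g p) (m4 p))),
           type_D (ricci g p) (e p) &
           forall v : 'cV[R]_5, v != 0 -> eval2 (g p) v v = 0 ->
             (eval2 (ricci g p) v v = 0 <->
              exists c : R, v = c *: ell p \/ v = c *: n p)]).
Proof.
move=> U g F T al be.
pose e p := ansatz_frame f m N w a0 aphi p.
have gram p : U p -> (forall a b, eval2 (g p) (e p a) (e p b) = null_gram R a b) /\
    (forall a b, eval2 (F p) (e p a) (e p b) = field_gram (al p) (be p) a b).
  move=> [Ip tp].
  have G a b := ansatz_frame_gram (f_gt0 _ Ip) (m_gt0 _ Ip) (N_gt0 _ Ip)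
    (radicand_gt0 _ Ip) tp a b (a0_smooth 0%N _ Ip) (aphi_smooth 0%N _ Ip).
  by split=> a b; have [] := G a b.
split=> [p Up M spectrum|].
  have [eg eF] := gram p Up.
  split=> [z|]; first exact: (frame_eigenvalue eg eF).
  exact: (frame_char_poly eg eF).
exists e => ell n m2 m3 m4; split=> [a mu|].
  exact: (smooth_ansatz_frame I_open).
split=> [p Up|einstein p Up]; have [eg eF] := gram p Up.
  split.
  - exact: (frame_null eg).
  (* The first three columns of [field_gram] are [al], [- al] and 0 times those of [null_gram]. *)
  - by split; apply: (frame_eigenvector eg eF); apply/matrixP => i j;
      rewrite !mxE; elim/ord5_ind: i => /=; ring.
  - exact: (frame_field_form eg eF).
  - exact: (type_D_field eF).
  - exact: (type_D_diag_gram (frame_stress_energy eg eF)).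
have Eric := frame_ricci eg eF (einstein p Up).
(* For the Ricci components the gaps [y - x] and [z - x] are 2 al^2 and 2 (al^2 + be^2), so
   positivity of the radicand makes both strict. *)
have al2 : 0 < al p ^+ 2.
  by rewrite exprn_gt0// mulr_gt0// sqrtr_gt0; apply: radicand_gt0; case: Up.
have be2 := sqr_ge0 (be p).
split.
- rewrite (frame_diag_form eg Eric) -/g; congr (_ *: _ + _ + _); ring.
- exact: (type_D_diag_gram Eric).
- by move=> v; apply: (frame_null_vectors eg Eric); lra.
Qed.
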